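(* Let $f$ be a non-square positive integer with $\sqrt{f}=[\,a_0;\overline{a_1,\dots,a_n,2a_0}\,]$ (so the period has length $n+1$), and let $(c,h)$ be the smallest pair of positive integers with $c^2-fh^2=1$. Let $f(t)=h^2t^2+2ct+f$. (i) If $n$ is even, then for all integers $t\ge 0$, $$\sqrt{f(t)}=[\,ht+a_0;\overline{a_1,\dots,a_n,2a_0,a_1,\dots,a_n,2(ht+a_0)}\,].$$ (ii) If $n$ is odd, then for all integers $t\ge 0$, $$\sqrt{f(t)}=[\,ht+a_0;\overline{a_1,\dots,a_n,2(ht+a_0)}\,].$$ (iii) In either case, for every integer $t\ge 0$, $X=h^2t+c$, $Y=h$ is the fundamental solution (smallest solution in positive integers) of $X^2-f(t)Y^2=1$.
   Context: $[\,b_0;\overline{b_1,\dots,b_k}\,]$ denotes the simple periodic continued fraction $b_0+\cfrac{1}{b_1+\cfrac{1}{b_2+\cdots}}$ with the overlined block repeating. The fundamental solution of $X^2-DY^2=1$ is its smallest solution in positive integers. *)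

(* Defs.v *)
From Stdlib Require Import ZArith List Reals.

Fixpoint cf_convergent (b : nat -> Z) (k : nat) : R :=
  match k with
  | O => IZR (b O)
  | S k' => (IZR (b O) + / cf_convergent (fun i => b (S i)) k')%R
  end.

(* x = [b 0; b 1, b 2, ...] as an infinite simple continued fraction.  [b 0]
   is an arbitrary integer; positivity of the later partial quotients
   keeps [/] away from 0 in the convergents and makes them converge. *)
Definition is_simple_cf (x : R) (b : nat -> Z) : Prop :=
  (forall i : nat, (0 < b (S i))%Z) /\ Un_cv (cf_convergent b) x.

(* The sequence b0, l, l, l, ...  For [l = nil] the later terms are 0, so that
   it is not the sequence of a simple continued fraction. *)
Definition periodic_seq (b0 : Z) (l : list Z) (i : nat) : Z :=
  match i with
  | O => b0
  | S j => nth (j mod length l) l 0%Z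
  end.

Definition is_periodic_cf (x : R) (b0 : Z) (l : list Z) : Prop :=
  is_simple_cf x (periodic_seq b0 l).

(* Periods are those of b 1, b 2, ...; the term b 0 is left out. *)
Definition is_period (b : nat -> Z) (m : nat) : Prop :=
  (0 < m)%nat /\ forall i : nat, b (S (i + m)) = b (S i).

Definition is_period_length (b : nat -> Z) (m : nat) : Prop :=
  is_period b m /\ forall m' : nat, is_period b m' -> (m <= m')%nat.

Definition is_pell_solution (D X Y : Z) : Prop :=
  (0 < X /\ 0 < Y /\ X ^ 2 - D * Y ^ 2 = 1)%Z.

(* For positive solutions X and Y increase together when D > 0, so being smallest
   in X, in Y, or in both coordinates is the same. *)
Definition is_fundamental_solution (D X Y : Z) : Prop :=
  is_pell_solution D X Y /\
  forall X' Y' : Z, is_pell_solution D X' Y' -> (X <= X' /\ Y <= Y')%Z.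

Definition fpoly (f c h t : Z) : Z := (h ^ 2 * t ^ 2 + 2 * c * t + f)%Z.

(* Main.v *)
Require Import Defs.
From Stdlib Require Import ZArith List Reals Lia Lra.
Import ListNotations.
Open Scope Z_scope.

(* Let [[A, B], [C, D]] be the product of the matrices [[a_i, 1], [1, 0]] over a
   list l.  For irrational sqrt f, an expansion sqrt f = [b0; l, 2 b0] forces
   B = C and A (f - b0^2) = 2 b0 B + D, and conversely.  If c = b0 A + B and h = A,
   these equations survive the passage from (f, b0) to (f(t), h t + b0), so l also
   serves for f(t).

   To see that c and h have this form, where l = a for n odd and l = a, 2 a0, a for
   n even, expand c/h = [b0; b_1, ..., b_m] with m odd.  Then m + 1 is a period of
   the expansion of sqrt f, so minimality of the period makes l a prefix of b, whence
   A <= h; as (b0 A + B, A) solves the Pell equation, equality holds.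

   For t > 0 we have h^2 < f(t), and a solution (X', Y') with Y' < h would make
   h^2 - Y'^2 a multiple of X' h + X Y' > h^2. *)

(** * Convergence and uniqueness of simple continued fractions *)

Lemma cf_convergent_ext (b b' : nat -> Z) (hb : forall i, b i = b' i) (k : nat) :
  cf_convergent b k = cf_convergent b' k.
Proof.
  revert b b' hb; induction k as [|k IH]; intros b b' hb; simpl.
  - now rewrite hb.
  - rewrite hb, (IH (fun i => b (S i)) (fun i => b' (S i))); auto.
Qed.

Lemma is_simple_cf_ext (x : R) (b b' : nat -> Z) (hb : forall i, b i = b' i) :
  is_simple_cf x b -> is_simple_cf x b'.
Proof.
  intros [hpos hcv]; split.
  - intro i; rewrite <- hb; apply hpos.
  - intros eps heps; destruct (hcv eps heps) as [N hN]; exists N.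
    intros k hk; rewrite <- (cf_convergent_ext b b' hb k); auto.
Qed.

Lemma cf_convergent_bounds (b : nat -> Z) (k : nat) :
  (forall i, 0 < b (S i)) ->
  (IZR (b O) <= cf_convergent b k <= IZR (b O) + 1)%R.
Proof.
  revert b; induction k as [|k IH]; intros b hpos; simpl; [lra|].
  destruct (IH (fun i => b (S i)) (fun i => hpos (S i))) as [h1 _]; simpl in h1.
  assert (h2 : (1 <= IZR (b 1%nat))%R) by (apply IZR_le; specialize (hpos O); lia).
  assert (h3 : (0 < / cf_convergent (fun i => b (S i)) k)%R)
    by (apply Rinv_0_lt_compat; lra).
  assert (h4 : (/ cf_convergent (fun i => b (S i)) k <= / 1)%R)
    by (apply Rinv_le_contravar; lra).
  rewrite Rinv_1 in h4; lra.
Qed.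

Lemma Un_cv_inv (u : nat -> R) (l m : R) (hm : (0 < m)%R) :
  (forall k, (m <= u k)%R) -> Un_cv u l -> Un_cv (fun k => / u k)%R (/ l)%R.
Proof.
  intros hu hl.
  assert (hlm : (m <= l)%R).
  { apply Rnot_lt_le; intro hlt.
    destruct (hl (m - l)%R) as [N hN]; [lra|].
    specialize (hN N (le_n N)); specialize (hu N).
    unfold Rdist in hN; apply Rabs_def2 in hN; lra. }
  intros eps heps.
  assert (hmm : (0 < m * m)%R) by nra.
  destruct (hl (eps * (m * m))%R) as [N hN]; [nra|].
  exists N; intros k hk; specialize (hN k hk); specialize (hu k).
  unfold Rdist in *.
  assert (hul : (m * m <= u k * l)%R) by nra.
  replace (/ u k - / l)%R with (- (u k - l) * / (u k * l))%R by (field; lra).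
  rewrite Rabs_mult, Rabs_Ropp, (Rabs_pos_eq (/ _))
    by (apply Rlt_le, Rinv_0_lt_compat; lra).
  apply Rmult_lt_reg_r with (u k * l)%R; [lra|].
  rewrite Rmult_assoc, Rinv_l by lra; nra.
Qed.

(** All convergents of the tail are at most [b 1 + 1], so their inverses stay above
    [m = / (b 1 + 1)]. This uniform bound keeps [x - b 0] positive in the limit and lets the
    inversion commute with the limit. *)
Lemma is_simple_cf_tail_weak (x : R) (b : nat -> Z) :
  is_simple_cf x b ->
  (IZR (b O) < x)%R /\ is_simple_cf (/ (x - IZR (b O))) (fun i => b (S i)).
Proof.
  intros [hpos hcv].
  set (b' := fun i => b (S i)).
  assert (hpos' : forall i, 0 < b' (S i)) by (intro i; apply hpos).
  assert (hb1 : (1 <= IZR (b' O))%R) by (apply IZR_le; specialize (hpos O); unfold b'; lia).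
  set (m := (/ (IZR (b' O) + 1))%R).
  assert (hm : (0 < m)%R) by (apply Rinv_0_lt_compat; lra).
  set (u := fun k => (cf_convergent b (S k) - IZR (b O))%R).
  assert (hu : forall k, u k = (/ cf_convergent b' k)%R)
    by (intro k; unfold u; simpl; fold b'; ring).
  assert (hum : forall k, (m <= u k)%R).
  { intro k; rewrite hu; apply Rinv_le_contravar;
      destruct (cf_convergent_bounds b' k hpos'); lra. }
  assert (hucv : Un_cv u (x - IZR (b O))).
  { intros eps heps; destruct (hcv eps heps) as [N hN]; exists N; intros k hk.
    unfold u, Rdist.
    replace (cf_convergent b (S k) - IZR (b O) - (x - IZR (b O)))%R
      with (cf_convergent b (S k) - x)%R by ring.
    apply hN; lia. }
  split.
  - apply Rnot_le_lt; intro hle.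
    destruct (hucv m hm) as [N hN].
    specialize (hN N (le_n N)); specialize (hum N).
    unfold Rdist in hN; apply Rabs_def2 in hN; lra.
  - split; [exact hpos'|].
    intros eps heps.
    destruct (Un_cv_inv u _ m hm hum hucv eps heps) as [N hN].
    exists N; intros k hk; specialize (hN k hk).
    now rewrite hu, Rinv_inv in hN.
Qed.

(** The weak form, applied to the tail as well, gives [1 <= b 1 < / (x - b 0)], whence the upper
    bound on [x]. *)
Lemma is_simple_cf_tail (x : R) (b : nat -> Z) :
  is_simple_cf x b ->
  (IZR (b O) < x < IZR (b O) + 1)%R /\ (1 < / (x - IZR (b O)))%R /\
  is_simple_cf (/ (x - IZR (b O))) (fun i => b (S i)).
Proof.
  intro hx; destruct (is_simple_cf_tail_weak x b hx) as [h1 h2].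
  destruct (is_simple_cf_tail_weak _ _ h2) as [h3 _].
  destruct hx as [hpos _]; specialize (hpos O).
  assert (hb : (1 <= IZR (b 1%nat))%R) by (apply IZR_le; lia).
  assert (h4 : (1 < / (x - IZR (b O)))%R) by lra.
  repeat split; auto; try apply h2.
  assert (h5 : (/ / (x - IZR (b O)) < / 1)%R) by (apply Rinv_lt_contravar; lra).
  rewrite Rinv_inv, Rinv_1 in h5; lra.
Qed.

Lemma IZR_floor_unique (x : R) (m m' : Z) :
  (IZR m < x < IZR m + 1)%R -> (IZR m' < x < IZR m' + 1)%R -> m = m'.
Proof.
  intros h h'.
  assert (m < m' + 1) by (apply lt_IZR; rewrite plus_IZR; lra).
  assert (m' < m + 1) by (apply lt_IZR; rewrite plus_IZR; lra).
  lia.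
Qed.

(** The first term is the floor of [x], and the remaining terms expand the same number
    [/ (x - b 0)]. *)
Lemma is_simple_cf_unique (x : R) (b b' : nat -> Z) (i : nat) :
  is_simple_cf x b -> is_simple_cf x b' -> b i = b' i.
Proof.
  revert x b b'; induction i as [|i IH]; intros x b b' hb hb';
    destruct (is_simple_cf_tail x b hb) as [h1 [_ h2]];
    destruct (is_simple_cf_tail x b' hb') as [h1' [_ h2']];
    assert (h0 := IZR_floor_unique x _ _ h1 h1'); [exact h0|].
  rewrite <- h0 in h2'.
  exact (IH _ (fun i => b (S i)) (fun i => b' (S i)) h2 h2').
Qed.

(** Here [X] lists the complete quotients. One step divides the error by [X 1] times a convergent of
    the tail, which may be close to 1, but two steps divide it by at least 4; hence the induction
    [two] carries [k] and [S k] together. *)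
Lemma cf_convergent_error (b : nat -> Z) (X : nat -> R) (k : nat) :
  (forall i, 0 < b (S i)) ->
  (forall i, X i = IZR (b i) + / X (S i))%R -> (forall i, (1 < X (S i))%R) ->
  (Rabs (cf_convergent b k - X O) <= 2 * (/ 2) ^ k)%R.
Proof.
  assert (step : forall b (X : nat -> R) k, (forall i, 0 < b (S i)) ->
    (forall i, X i = IZR (b i) + / X (S i))%R -> (forall i, (1 < X (S i))%R) ->
    (1 <= cf_convergent (fun i => b (S i)) k)%R /\
    (Rabs (cf_convergent b (S k) - X O) =
     Rabs (cf_convergent (fun i => b (S i)) k - X 1%nat)
       * / (X 1%nat * cf_convergent (fun i => b (S i)) k))%R).
  { clear; intros b X k hpos hX hX1; simpl.
    assert (h1 : (1 <= IZR (b 1%nat))%R) by (apply IZR_le; specialize (hpos O); lia).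
    destruct (cf_convergent_bounds (fun i => b (S i)) k (fun i => hpos (S i))) as [h2 _].
    simpl in h2; set (u := cf_convergent (fun i => b (S i)) k) in *.
    assert (h3 := hX1 O); split; [lra|].
    rewrite (hX O), <- (Rabs_Ropp (u - _)).
    rewrite <- (Rabs_pos_eq (/ (X 1%nat * u))) by (apply Rlt_le, Rinv_0_lt_compat; nra).
    rewrite <- Rabs_mult; f_equal; field; lra. }
  assert (two : forall k,
    (forall b (X : nat -> R), (forall i, 0 < b (S i)) ->
      (forall i, X i = IZR (b i) + / X (S i))%R -> (forall i, (1 < X (S i))%R) ->
      (Rabs (cf_convergent b k - X O) <= 2 * (/ 2) ^ k)%R) /\
    (forall b (X : nat -> R), (forall i, 0 < b (S i)) ->
      (forall i, X i = IZR (b i) + / X (S i))%R -> (forall i, (1 < X (S i))%R) ->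
      (Rabs (cf_convergent b (S k) - X O) <= 2 * (/ 2) ^ (S k))%R)).
  { clear k b X; induction k as [|k [IH1 IH2]].
    - assert (base : forall b (X : nat -> R),
        (forall i, X i = IZR (b i) + / X (S i))%R -> (forall i, (1 < X (S i))%R) ->
        (Rabs (cf_convergent b O - X O) <= 1)%R).
      { intros b X hX hX1; simpl; rewrite (hX O); specialize (hX1 O).
        assert (h1 : (0 < / X 1%nat)%R) by (apply Rinv_0_lt_compat; lra).
        assert (h2 : (/ X 1%nat <= / 1)%R) by (apply Rinv_le_contravar; lra).
        rewrite Rinv_1 in h2; apply Rabs_le; lra. }
      split; intros b X hpos hX hX1.
      + specialize (base b X hX hX1); simpl in *; lra.
      + destruct (step b X O hpos hX hX1) as [h1 h2]; rewrite h2.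
        specialize (base (fun i => b (S i)) (fun i => X (S i)) (fun i => hX (S i))
          (fun i => hX1 (S i))); simpl cf_convergent in base.
        assert (h3 := hX1 O); simpl in *.
        assert (h4 : (0 < / (X 1%nat * IZR (b 1%nat)))%R)
          by (apply Rinv_0_lt_compat; nra).
        assert (h5 : (/ (X 1%nat * IZR (b 1%nat)) <= / 1)%R)
          by (apply Rinv_le_contravar; nra).
        rewrite Rinv_1 in h5.
        pose proof (Rabs_pos (IZR (b 1%nat) - X 1%nat)%R); nra.
    - split; [exact IH2|]; intros b X hpos hX hX1.
      destruct (step b X (S k) hpos hX hX1) as [h1 h2].
      destruct (step (fun i => b (S i)) (fun i => X (S i)) k (fun i => hpos (S i))
        (fun i => hX (S i)) (fun i => hX1 (S i))) as [h1' h2'].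
      specialize (IH1 (fun i => b (S (S i))) (fun i => X (S (S i)))
        (fun i => hpos (S (S i))) (fun i => hX (S (S i))) (fun i => hX1 (S (S i)))).
      rewrite h2, h2'; cbv beta in *.
      assert (e : (cf_convergent (fun i => b (S i)) (S k)
        = IZR (b 1%nat) + / cf_convergent (fun i => b (S (S i))) k)%R) by reflexivity.
      rewrite e in *.
      set (u := cf_convergent (fun i => b (S (S i))) k) in *.
      assert (hb : (1 <= IZR (b 1%nat))%R) by (apply IZR_le; specialize (hpos O); lia).
      assert (h3 := hX1 1%nat).
      rewrite Rmult_assoc, <- Rinv_mult.
      (* Two successive denominators multiply to at least 4, as
         [X 1 * X 2 = b 1 * X 2 + 1 >= 2], and likewise for the convergents. *)
      assert (hxx : (X 2%nat * X 1%nat = IZR (b 1%nat) * X 2%nat + 1)%R)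
        by (rewrite (hX 1%nat); field; lra).
      assert (huu : (u * (IZR (b 1%nat) + / u) = IZR (b 1%nat) * u + 1)%R)
        by (field; lra).
      replace (X 2%nat * u * (X 1%nat * (IZR (b 1%nat) + / u)))%R
        with ((IZR (b 1%nat) * X 2%nat + 1) * (IZR (b 1%nat) * u + 1))%R
        by (rewrite <- hxx, <- huu; ring).
      assert (hp : (2 <= IZR (b 1%nat) * X 2%nat + 1)%R) by nra.
      assert (hq : (2 <= IZR (b 1%nat) * u + 1)%R) by nra.
      set (p := (IZR (b 1%nat) * X 2%nat + 1)%R) in *.
      set (q := (IZR (b 1%nat) * u + 1)%R) in *.
      assert (h4 : (0 < / (p * q))%R) by (apply Rinv_0_lt_compat; nra).
      assert (h5 : (/ (p * q) <= / 4)%R) by (apply Rinv_le_contravar; nra).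
      pose proof (Rabs_pos (u - X 2%nat)%R).
      simpl pow; nra. }
  intros; now apply (proj1 (two k)).
Qed.

Lemma is_simple_cf_of_quotients (b : nat -> Z) (X : nat -> R) :
  (forall i, 0 < b (S i)) ->
  (forall i, X i = IZR (b i) + / X (S i))%R -> (forall i, (1 < X (S i))%R) ->
  is_simple_cf (X O) b.
Proof.
  intros hpos hX hX1; split; [exact hpos|].
  intros eps heps.
  destruct (pow_lt_1_zero (/ 2)%R) with (y := (eps / 2)%R) as [N hN]; [|lra|].
  { rewrite Rabs_pos_eq; lra. }
  exists N; intros k hk; specialize (hN k hk).
  apply Rabs_def2 in hN; unfold Rdist.
  pose proof (cf_convergent_error b X k hpos hX hX1); lra.
Qed.

(** * Periodic expansions as fixed points of finite continued fractions *)

Definition cf_eval (l : list Z) (y : R) : R :=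
  fold_right (fun a r => IZR a + / r)%R y l.

Lemma cf_eval_gt_1 (l : list Z) (y : R) :
  Forall (Z.lt 0) l -> (1 < y)%R -> (1 < cf_eval l y)%R.
Proof.
  induction 1 as [|a l ha hl IH]; intro hy; simpl; [exact hy|].
  assert (h1 : (1 <= IZR a)%R) by (apply IZR_le; lia).
  assert (h2 : (0 < / cf_eval l y)%R)
    by (apply Rinv_0_lt_compat; specialize (IH hy); lra).
  fold (cf_eval l y); lra.
Qed.

Lemma cf_eval_rcons (l : list Z) (a : Z) (y : R) :
  cf_eval (l ++ [a]) y = cf_eval l (IZR a + / y).
Proof. apply fold_right_app. Qed.

Lemma is_simple_cf_split (x : R) (b : nat -> Z) (m : nat) :
  is_simple_cf x b ->
  exists y : R, x = cf_eval (map b (seq 0 m)) y /\ is_simple_cf y (fun i => b (m + i)%nat).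
Proof.
  revert x b; induction m as [|m IH]; intros x b hx.
  - exists x; split; [reflexivity|exact hx].
  - destruct (is_simple_cf_tail x b hx) as [h1 [_ h2]].
    destruct (IH _ _ h2) as [y [hy1 hy2]].
    exists y; split; [|exact hy2].
    cbn [seq map]; rewrite <- seq_shift, map_map.
    change (x = IZR (b O) + / cf_eval (map (fun i => b (S i)) (seq 0 m)) y)%R.
    rewrite <- hy1, Rinv_inv; ring.
Qed.

Lemma map_nth_mod_seq (l : list Z) :
  map (fun i => nth (i mod length l) l 0) (seq 0 (length l)) = l.
Proof.
  apply (nth_ext _ _ 0 0).
  - now rewrite length_map, length_seq.
  - intros i hi; rewrite length_map, length_seq in hi.
    rewrite nth_indep with (d' := nth (O mod length l) l 0)
      by now rewrite length_map, length_seq.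
    rewrite (map_nth (fun i => nth (i mod length l) l 0)), seq_nth by exact hi; simpl.
    now rewrite Nat.mod_small.
Qed.

Lemma periodic_seq_prefix (b0 : Z) (l : list Z) :
  map (periodic_seq b0 l) (seq 1 (length l)) = l.
Proof.
  rewrite <- seq_shift, map_map; exact (map_nth_mod_seq l).
Qed.

(** The tail after [b0] is purely periodic, so the complete quotient one block later has the same
    expansion, and therefore the same value. *)
Lemma is_periodic_cf_eval (x : R) (b0 : Z) (l : list Z) :
  l <> [] -> is_periodic_cf x b0 l ->
  (/ (x - IZR b0) = cf_eval l (/ (x - IZR b0)))%R.
Proof.
  intros hl hx; destruct (is_simple_cf_tail _ _ hx) as [_ [_ h1]]; simpl in h1.
  destruct (is_simple_cf_split _ _ (length l) h1) as [y [hy1 hy2]].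
  rewrite map_nth_mod_seq in hy1.
  assert (hlen : length l <> O) by (destruct l; [easy|discriminate]).
  apply is_simple_cf_ext with (b' := fun i => nth (i mod length l) l 0) in hy2.
  - destruct h1 as [_ h1], hy2 as [_ hy2].
    now rewrite (UL_sequence _ _ _ hy2 h1) in hy1.
  - intro i; f_equal.
    replace (length l + i)%nat with (i + 1 * length l)%nat by lia.
    now apply Nat.Div0.mod_add.
Qed.

Lemma skipn_nth_cons (l : list Z) (j : nat) :
  (j < length l)%nat -> skipn j l = nth j l 0 :: skipn (S j) l.
Proof.
  revert j; induction l as [|a l IH]; intros [|j] hj; simpl in *; try lia; auto.
  now rewrite IH by lia.
Qed.

(** The complete quotients are the suffixes of [l] evaluated at [y]; at the end of a block the
    fixed-point equation replaces [y] by the whole block again. *)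
Lemma is_periodic_cf_of_eval (y : R) (b0 : Z) (l : list Z) :
  l <> [] -> Forall (Z.lt 0) l -> (1 < y)%R -> y = cf_eval l y ->
  is_periodic_cf (IZR b0 + / y) b0 l.
Proof.
  intros hl hpos hy hev.
  assert (hlen : length l <> O) by (destruct l; [easy|discriminate]).
  assert (hmod : forall i, (i mod length l < length l)%nat)
    by (intro i; now apply Nat.mod_upper_bound).
  apply (is_simple_cf_of_quotients _ (fun i => match i with
    | O => (IZR b0 + / y)%R
    | S j => cf_eval (skipn (j mod length l) l) y
    end)).
  - intro i; simpl; rewrite Forall_forall in hpos; apply hpos, nth_In, hmod.
  - intros [|i].
    + rewrite Nat.Div0.mod_0_l; do 2 f_equal; exact hev.
    + simpl periodic_seq; rewrite (skipn_nth_cons l (i mod length l)) by apply hmod.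
      unfold cf_eval at 1; cbn [fold_right]; do 2 f_equal.
      assert (hS : (S i mod length l = S (i mod length l) mod length l)%nat)
        by exact (eq_sym (Nat.Div0.add_mod_idemp_r 1 i (length l))).
      rewrite hS.
      specialize (hmod i).
      destruct (Nat.eq_dec (S (i mod length l)) (length l)) as [e|e].
      * rewrite e, Nat.Div0.mod_same, skipn_all; exact hev.
      * rewrite (Nat.mod_small (S _)) by lia; reflexivity.
  - intro i; apply cf_eval_gt_1; [|exact hy].
    rewrite <- (firstn_skipn (i mod length l)) in hpos.
    now apply Forall_app in hpos.
Qed.

(** * Matrices of continued fractions *)

(* For [M = cf_mat [b1; ...; bk]], the convergent [b0; b1, ..., bk] is
   (b0 * m11 M + m21 M) / m11 M. *)
Record mat2 := Mat2 { m11 : Z; m12 : Z; m21 : Z; m22 : Z }.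

Fixpoint cf_mat (l : list Z) : mat2 :=
  match l with
  | [] => Mat2 1 0 0 1
  | a :: l' =>
    let M := cf_mat l' in
    Mat2 (a * m11 M + m21 M) (a * m12 M + m22 M) (m11 M) (m12 M)
  end.

Lemma cf_mat_nonneg (l : list Z) :
  Forall (Z.lt 0) l ->
  0 < m11 (cf_mat l) /\ 0 <= m12 (cf_mat l) /\
  0 <= m21 (cf_mat l) /\ 0 <= m22 (cf_mat l).
Proof.
  induction 1 as [|a l ha hl IH]; simpl; [lia|].
  destruct IH as [h1 [h2 [h3 h4]]]; repeat split; nia.
Qed.

Lemma cf_mat_le (l : list Z) :
  Forall (Z.lt 0) l -> m21 (cf_mat l) <= m11 (cf_mat l).
Proof.
  intros [|a l' ha hl]; simpl; [lia|].
  pose proof (cf_mat_nonneg l' hl); nia.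
Qed.

(** The second column belongs to the list without its last entry, so its entries are no larger. The
    list is a cons because the identity matrix violates the second inequality. *)
Lemma cf_mat_cons_le (a : Z) (l : list Z) :
  0 < a -> Forall (Z.lt 0) l ->
  m12 (cf_mat (a :: l)) <= m11 (cf_mat (a :: l)) /\
  m22 (cf_mat (a :: l)) <= m21 (cf_mat (a :: l)).
Proof.
  intros ha hl; revert a ha.
  induction hl as [|a' l ha' hl IH]; intros a ha; simpl; [lia|].
  specialize (IH a' ha'); simpl in IH; nia.
Qed.

Lemma cf_mat_det (l : list Z) :
  m11 (cf_mat l) * m22 (cf_mat l) - m12 (cf_mat l) * m21 (cf_mat l) =
  if Nat.even (length l) then 1 else -1.
Proof.
  induction l as [|a l IH]; [reflexivity|].
  cbn [length]; rewrite Nat.even_succ, <- Nat.negb_even; simpl.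
  destruct (Nat.even (length l)); simpl; lia.
Qed.

Lemma cf_mat_app_le (l l' : list Z) :
  Forall (Z.lt 0) l -> Forall (Z.lt 0) l' ->
  m11 (cf_mat l) <= m11 (cf_mat (l ++ l')) /\
  m21 (cf_mat l) <= m21 (cf_mat (l ++ l')).
Proof.
  intros hl hl'.
  induction hl as [|a l ha hl IH]; simpl.
  - pose proof (cf_mat_nonneg l' hl'); lia.
  - nia.
Qed.

(** The matrix acts on [y] as a Moebius transformation; the equation is cross-multiplied to avoid a
    quotient. *)
Lemma cf_eval_mat (l : list Z) (y : R) :
  Forall (Z.lt 0) l -> (0 < y)%R ->
  (0 < cf_eval l y)%R /\
  (cf_eval l y * (IZR (m21 (cf_mat l)) * y + IZR (m22 (cf_mat l))) =
   IZR (m11 (cf_mat l)) * y + IZR (m12 (cf_mat l)))%R.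
Proof.
  intros hl hy; induction hl as [|a l ha hl [IH1 IH2]]; simpl; [split; lra|].
  assert (h1 : (0 < IZR a)%R) by now apply IZR_lt.
  fold (cf_eval l y).
  assert (h2 : (0 < / cf_eval l y)%R) by now apply Rinv_0_lt_compat.
  split; [lra|].
  rewrite !plus_IZR, !mult_IZR.
  transitivity (IZR a * (IZR (m11 (cf_mat l)) * y + IZR (m12 (cf_mat l)))
    + (IZR (m21 (cf_mat l)) * y + IZR (m22 (cf_mat l))))%R; [|ring].
  rewrite <- IH2; field; lra.
Qed.

(** * Irrationality of [sqrt f] and the matrix criterion for its expansion *)

(** After division by the gcd, [v'] divides [u' * u'] and is coprime to [u'], so it is a unit. *)
Lemma square_of_square_ratio (u v f : Z) :
  v <> 0 -> v * v * f = u * u -> exists m : Z, f = m ^ 2.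
Proof.
  intros hv h.
  assert (hg : Z.gcd u v <> 0) by (intro e; apply Z.gcd_eq_0_r in e; lia).
  destruct (Z.gcd_divide_l u v) as [u' hu], (Z.gcd_divide_r u v) as [v' hv'].
  pose proof (Z.gcd_div_gcd u v _ hg eq_refl) as hcop.
  set (g := Z.gcd u v) in *; clearbody g.
  rewrite hu, hv', !Z.div_mul in hcop by exact hg.
  assert (h' : v' * v' * f = u' * u').
  { apply Z.mul_cancel_l with (p := g * g); [nia|].
    transitivity (v * v * f); [rewrite hv'; ring|rewrite h, hu; ring]. }
  assert (hd : (v' | u')).
  { apply Z.gauss with u'; [exists (v' * f); lia|]. now rewrite Z.gcd_comm. }
  assert (h1 : (v' | 1)) by (rewrite <- hcop; now apply Z.gcd_greatest).
  exists u'; destruct (Z.divide_1_r _ h1); subst v'; lia.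
Qed.

Lemma sqrt_IZR_sqr (f : Z) : 0 < f -> (sqrt (IZR f) * sqrt (IZR f) = IZR f)%R.
Proof. intro hf; apply sqrt_sqrt, IZR_le; lia. Qed.

Lemma sqrt_IZR_ge_1 (f : Z) : 0 < f -> (1 <= sqrt (IZR f))%R.
Proof.
  intro hf; rewrite <- sqrt_1; apply sqrt_le_1_alt, IZR_le; lia.
Qed.

Lemma sqrt_IZR_independent (f u v : Z) :
  0 < f -> ~ (exists m : Z, f = m ^ 2) ->
  (IZR u + IZR v * sqrt (IZR f) = 0)%R -> u = 0 /\ v = 0.
Proof.
  intros hf hfsq h.
  pose proof (sqrt_IZR_sqr f hf) as hs; set (s := sqrt (IZR f)) in *.
  destruct (Z.eq_dec v 0) as [e|e].
  - subst v; split; [apply eq_IZR; lra|reflexivity].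
  - exfalso; apply hfsq, (square_of_square_ratio u v f e), eq_IZR.
    rewrite !mult_IZR, <- hs; replace (IZR u) with (- (IZR v * s))%R by lra; ring.
Qed.

Lemma is_periodic_cf_pos (x : R) (b0 : Z) (l : list Z) :
  is_periodic_cf x b0 l -> Forall (Z.lt 0) l.
Proof.
  intros [hpos _]; apply Forall_forall; intros z hz.
  apply (In_nth _ _ 0) in hz; destruct hz as [i [hi hz]].
  specialize (hpos i); simpl in hpos; rewrite Nat.mod_small in hpos by exact hi; lia.
Qed.

(** The complete quotient reached after [l] is [2 * b0 + (s - b0) = s + b0]. Thus the matrix of [l]
    sends [s + b0] to [/ (s - b0)], and the coefficients of 1 and [s] can be compared. *)
Lemma sqrt_periodic_cf_mat (f b0 : Z) (l : list Z) :
  0 < f -> ~ (exists m : Z, f = m ^ 2) ->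
  is_periodic_cf (sqrt (IZR f)) b0 (l ++ [2 * b0]) ->
  m21 (cf_mat l) = m12 (cf_mat l) /\
  m11 (cf_mat l) * (f - b0 * b0) = 2 * b0 * m12 (cf_mat l) + m22 (cf_mat l).
Proof.
  intros hf hfsq hcf.
  assert (hpos := is_periodic_cf_pos _ _ _ hcf).
  apply Forall_app in hpos; destruct hpos as [hl hb0]; apply Forall_inv in hb0.
  assert (hb0' : (0 < IZR b0)%R) by (apply IZR_lt; lia).
  destruct (is_simple_cf_tail _ _ hcf) as [[h1 _] _]; simpl in h1.
  apply is_periodic_cf_eval in hcf; [|now destruct l].
  pose proof (sqrt_IZR_sqr f hf) as hs; set (s := sqrt (IZR f)) in *.
  rewrite cf_eval_rcons, Rinv_inv, mult_IZR in hcf.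
  replace (2 * IZR b0 + (s - IZR b0))%R with (s + IZR b0)%R in hcf by ring.
  destruct (cf_eval_mat l (s + IZR b0)%R hl) as [_ h2]; [lra|].
  rewrite <- hcf in h2.
  set (A := m11 (cf_mat l)) in *; set (B := m12 (cf_mat l)) in *;
  set (C := m21 (cf_mat l)) in *; set (D := m22 (cf_mat l)) in *.
  assert (h3 : (IZR C * (s + IZR b0) + IZR D
    = (s - IZR b0) * (IZR A * (s + IZR b0) + IZR B))%R)
    by (rewrite <- h2; field; lra).
  (* With [s * s = f], these are the rational part and the coefficient of [s] in [h3]; [B = C] then
     merges [b0 * B + b0 * C] into [2 * b0 * B]. *)
  destruct (sqrt_IZR_independent f (A * (f - b0 * b0) - b0 * B - b0 * C - D) (B - C))
    as [h4 h5]; auto; [|nia].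
  rewrite !minus_IZR, !mult_IZR, !minus_IZR, !mult_IZR; fold s; rewrite <- hs; lra.
Qed.

(** The same computation backwards: [y], the value of [l] at [s + b0], satisfies [y * (s - b0) = 1],
    so [2 * b0 + / y = s + b0] and [y] is fixed by the block. *)
Lemma sqrt_periodic_cf_of_mat (f b0 : Z) (l : list Z) :
  0 < f -> 0 < b0 -> Forall (Z.lt 0) l ->
  m21 (cf_mat l) = m12 (cf_mat l) ->
  m11 (cf_mat l) * (f - b0 * b0) = 2 * b0 * m12 (cf_mat l) + m22 (cf_mat l) ->
  is_periodic_cf (sqrt (IZR f)) b0 (l ++ [2 * b0]).
Proof.
  intros hf hb0 hl hsym heq.
  pose proof (sqrt_IZR_sqr f hf) as hs; pose proof (sqrt_IZR_ge_1 f hf) as hs1.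
  set (s := sqrt (IZR f)) in *.
  assert (hb0' : (1 <= IZR b0)%R) by (apply IZR_le; lia).
  assert (hy : (1 < cf_eval l (s + IZR b0))%R) by (apply cf_eval_gt_1; [exact hl|lra]).
  destruct (cf_eval_mat l (s + IZR b0)%R hl) as [_ h2]; [lra|].
  destruct (cf_mat_nonneg l hl) as [hA [hB [_ hD]]].
  apply (f_equal IZR) in heq.
  rewrite plus_IZR, !mult_IZR, minus_IZR, mult_IZR, <- hs in heq.
  rewrite hsym in h2.
  set (y := cf_eval l (s + IZR b0)) in *.
  apply IZR_lt in hA; apply IZR_le in hB, hD.
  set (A := IZR (m11 (cf_mat l))) in *; set (B := IZR (m12 (cf_mat l))) in *;
  set (D := IZR (m22 (cf_mat l))) in *.
  assert (hd : (0 < A * (s + IZR b0) + B)%R) by nra.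
  assert (h3 : (y * (s - IZR b0) = 1)%R).
  { apply Rmult_eq_reg_r with (A * (s + IZR b0) + B)%R; [|lra].
    rewrite Rmult_assoc.
    replace ((s - IZR b0) * (A * (s + IZR b0) + B))%R with (B * (s + IZR b0) + D)%R
      by lra.
    lra. }
  assert (h4 : (s - IZR b0 = / y)%R)
    by (apply Rmult_eq_reg_l with y; [rewrite h3, Rinv_r; lra|lra]).
  replace s with (IZR b0 + / y)%R by lra.
  apply is_periodic_cf_of_eval; auto.
  - now destruct l.
  - apply Forall_app; split; [exact hl|repeat constructor; lia].
  - rewrite cf_eval_rcons, mult_IZR, <- h4.
    replace (2 * IZR b0 + (s - IZR b0))%R with (s + IZR b0)%R by ring; reflexivity.
Qed.

(** * Expansions of rational numbers *)

(* Either parity of the length can be achieved, as [..., 1] = [... + 1]. *)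
Lemma rational_cf (c h : Z) (e : bool) :
  0 < h -> Z.gcd c h = 1 ->
  exists (b0 : Z) (l : list Z), Forall (Z.lt 0) l /\ Nat.even (length l) = e /\
    c = b0 * m11 (cf_mat l) + m21 (cf_mat l) /\ h = m11 (cf_mat l).
Proof.
  intro hh; assert (hh' : 0 <= h) by lia; revert c e hh.
  pattern h; apply Zlt_0_ind; [|exact hh']; clear h hh'.
  intros h IH _ c e hh hcop.
  destruct (Z.eq_dec h 1) as [->|hh1].
  - destruct e.
    + exists c, []; repeat split; simpl; auto; lia.
    + exists (c - 1), [1]; repeat split; simpl; try lia; repeat constructor; lia.
  - pose proof (Z.div_mod c h ltac:(lia)) as hdm.
    pose proof (Z.mod_pos_bound c h hh) as hr.
    set (r := c mod h) in *; set (q := c / h) in *.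
    assert (hcop' : Z.gcd h r = 1) by
      (unfold r; now rewrite Z.gcd_comm, Z.gcd_mod, Z.gcd_comm by lia).
    assert (hr0 : r <> 0).
    { intro e0; rewrite e0, Z.gcd_0_r in hcop'; lia. }
    (* Euclid's step: if [h / r] is [[b0; l]], then [c / h] is [[q; b0, l]], whose list is one
       longer; hence the negated parity. *)
    destruct (IH r ltac:(lia) h (negb e) ltac:(lia) hcop')
      as [b0 [l [hl [hlen [h1 h2]]]]].
    (* From [h = b0 * r + m21 (cf_mat l)] and [m21 (cf_mat l) <= r < h], the quotient [b0] is
       positive, as its new place in the list demands. *)
    pose proof (cf_mat_le l hl).
    exists q, (b0 :: l); repeat split.
    + constructor; [nia|exact hl].
    + cbn [length]; rewrite Nat.even_succ, <- Nat.negb_even, hlen.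
      now destruct e.
    + simpl; rewrite <- h1, <- h2; lia.
    + simpl; lia.
Qed.

(** * The Pell equation for [f(t)] *)

Lemma pell_shift_fundamental (f c h t : Z) :
  0 < f -> 0 <= t -> is_fundamental_solution f c h ->
  is_fundamental_solution (fpoly f c h t) (h ^ 2 * t + c) h.
Proof.
  intros hf ht hfund.
  destruct (Z.eq_dec t 0) as [->|ht0].
  { now replace (fpoly f c h 0) with f by (unfold fpoly; ring);
    rewrite Z.mul_0_r, Z.add_0_l. }
  destruct hfund as [[hc [hh hpell]] _].
  set (F := fpoly f c h t); set (X := h ^ 2 * t + c).
  assert (ht1 : 0 < t) by lia; pose proof (Z.mul_pos_pos h h hh hh) as hhh.
  assert (hX : X ^ 2 - F * h ^ 2 = 1).
  { unfold X, F, fpoly; rewrite <- hpell; ring. }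
  assert (hX0 : 0 < X) by (unfold X; nia).
  assert (hF : h * h < F).
  { assert (h * h * 1 <= h * h * (t * t)) by (apply Z.mul_le_mono_nonneg_l; nia).
    pose proof (Z.mul_pos_pos c t hc ht1); unfold F, fpoly; lia. }
  clearbody F X.
  split; [repeat split; auto|].
  intros X' Y' [hX' [hY' hpell']].
  assert (hY : h <= Y').
  { apply Z.nlt_ge; intro hlt.
    (* With [F > h^2], every solution has [X' > h], yet the left factor is positive. *)
    assert (e : (X' * h - X * Y') * (X' * h + X * Y') = h * h - Y' * Y').
    { transitivity ((X' ^ 2 - F * Y' ^ 2) * (h * h) - (X ^ 2 - F * h ^ 2) * (Y' * Y'));
        [ring|rewrite hX, hpell'; ring]. }
    assert (h1 : h * h < X' * X').
    { assert (F * 1 <= F * (Y' * Y')) by (apply Z.mul_le_mono_nonneg_l; nia); lia. }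
    apply Z.square_lt_simpl_nonneg in h1; [|lia].
    assert (h2 : 0 < X' * h + X * Y') by nia.
    assert (h3 : 0 < X' * h - X * Y').
    { apply Z.mul_pos_cancel_r with (X' * h + X * Y'); [exact h2|].
      rewrite e; nia. }
    nia. }
  split; [|exact hY].
  apply Z.square_le_simpl_nonneg; [lia|].
  assert (F * (h * h) <= F * (Y' * Y')) by (apply Z.mul_le_mono_nonneg_l; nia).
  lia.
Qed.

(** * Periods obtained from Pell solutions *)

Lemma periodic_seq_prefix_app (b0 : Z) (l l' : list Z) :
  map (periodic_seq b0 (l ++ l')) (seq 1 (length l)) = l.
Proof.
  pose proof (periodic_seq_prefix b0 (l ++ l')) as e.
  rewrite length_app, seq_app, map_app in e.
  apply (f_equal (firstn (length l))) in e.
  rewrite !firstn_app, length_map, length_seq, Nat.sub_diag, !firstn_O, !app_nil_r,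
    firstn_all, firstn_all2 in e; [exact e|].
  rewrite length_map, length_seq; lia.
Qed.

Lemma is_period_periodic_seq (b0 : Z) (l : list Z) :
  l <> [] -> is_period (periodic_seq b0 l) (length l).
Proof.
  intro hl; split; [destruct l; [easy|simpl; lia]|].
  intro i; simpl; rewrite <- (Nat.mul_1_l (length l)) at 1.
  now rewrite Nat.Div0.mod_add.
Qed.

(* Writing c/h = [b0; b], the matrices of [b0 :: b] and of the automorphism
   s |-> (c s + f h) / (h s + c) fixing s = sqrt f share their first column and
   their determinant, so they differ by a translation s |-> s + k: hence
   s = [b0; b, s + k]. *)
Lemma pell_solution_period (f c h : Z) (beta : nat -> Z) :
  0 < f -> is_simple_cf (sqrt (IZR f)) beta -> is_pell_solution f c h ->
  exists m : nat, Nat.even m = false /\ is_period beta (m + 1) /\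
    h = m11 (cf_mat (map beta (seq 1 m))).
Proof.
  intros hf hbeta [hc [hh hpell]].
  assert (hcop : Z.gcd c h = 1).
  { destruct (Z.divide_1_r (Z.gcd c h)) as [e|e]; [|exact e|].
    - replace 1 with (c * c - (f * h) * h) by (rewrite <- hpell; ring).
      apply Z.divide_sub_r; apply Z.divide_mul_r;
        [apply Z.gcd_divide_l|apply Z.gcd_divide_r].
    - pose proof (Z.gcd_nonneg c h); lia. }
  destruct (rational_cf c h false hh hcop) as [b0 [b [hb [hlen [hcb hhb]]]]].
  pose proof (cf_mat_det b) as hdet; rewrite hlen in hdet.
  destruct (cf_mat_nonneg b hb) as [_ [hB0 _]].
  assert (hBh : m12 (cf_mat b) <= h).
  { rewrite hhb; destruct hb as [|a b ha hb]; [discriminate hlen|].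
    now apply cf_mat_cons_le. }
  pose proof (cf_eval_mat b) as hev; specialize (hev) with (1 := hb).
  rewrite <- hhb in *.
  set (B := m12 (cf_mat b)) in *; set (C := m21 (cf_mat b)) in *;
  set (D := m22 (cf_mat b)) in *.
  (* Equality of the two determinants reads [c * (c - B) = h * (f * h - (b0 * B + D))], and [h] is
     coprime to [c]. *)
  assert (hk : exists k, c - B = k * h).
  { apply (Z.gauss h c); [|now rewrite Z.gcd_comm].
    exists (f * h - (b0 * B + D)); nia. }
  destruct hk as [k hk].
  (* [B <= h < c] makes the translation [k] positive, so that [s + k] exceeds 1 and [k + b0] can be
     a partial quotient. *)
  assert (hch : h < c) by nia.
  assert (hk0 : 0 < k) by nia.
  pose proof (sqrt_IZR_sqr f hf) as hs; pose proof (sqrt_IZR_ge_1 f hf) as hs1.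
  set (s := sqrt (IZR f)) in *.
  assert (hkR : (1 <= IZR k)%R) by (apply IZR_le; lia).
  assert (hy1 : (1 < cf_eval b (s + IZR k))%R) by (apply cf_eval_gt_1; [exact hb|lra]).
  destruct (hev (s + IZR k)%R) as [_ hy]; [lra|].
  set (y := cf_eval b (s + IZR k)) in *.
  assert (hhR : (0 < IZR h)%R) by now apply IZR_lt.
  assert (hBR : (0 <= IZR B)%R) by now apply IZR_le.
  assert (hsy : ((s - IZR b0) * y = 1)%R).
  { assert (e : ((s - IZR b0) * (IZR h * (s + IZR k) + IZR B)
      = IZR C * (s + IZR k) + IZR D)%R).
    { assert (e1 : c * k + b0 * B + D = f * h) by nia.
      apply (f_equal IZR) in hcb, hk, e1.
      rewrite plus_IZR, mult_IZR in hcb; rewrite minus_IZR, mult_IZR in hk.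
      rewrite !plus_IZR, !mult_IZR, <- hs in e1.
      replace (IZR C) with (IZR c - IZR b0 * IZR h)%R by lra.
      replace (IZR D) with (s * s * IZR h - IZR c * IZR k - IZR b0 * IZR B)%R by lra.
      replace (IZR c) with (IZR k * IZR h + IZR B)%R by lra; ring. }
    apply Rmult_eq_reg_r with (IZR C * (s + IZR k) + IZR D)%R.
    - rewrite Rmult_assoc, hy; lra.
    - intro e0; rewrite e0 in hy; nra. }
  assert (hsy' : (s = IZR b0 + / y)%R).
  { apply Rmult_eq_reg_r with y; [|lra].
    rewrite Rmult_plus_distr_r, Rinv_l; lra. }
  assert (hb0 : 0 < b0).
  { apply lt_IZR.
    assert (/ y < / 1)%R by (apply Rinv_lt_contravar; lra).
    rewrite Rinv_1 in *; lra. }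
  (* Since [s + k = (k + b0) + / y], the entry [k + b0] closes the block. Uniqueness then identifies
     [beta] with this expansion. *)
  assert (hcf : is_periodic_cf s b0 (b ++ [k + b0])).
  { rewrite hsy'; apply is_periodic_cf_of_eval; auto.
    - now destruct b.
    - apply Forall_app; split; [exact hb|repeat constructor; lia].
    - rewrite cf_eval_rcons, plus_IZR.
      replace (IZR k + IZR b0 + / y)%R with (s + IZR k)%R by lra; reflexivity. }
  assert (hbeq : forall i, beta i = periodic_seq b0 (b ++ [k + b0]) i)
    by (intro i; exact (is_simple_cf_unique s _ _ i hbeta hcf)).
  exists (length b); repeat split; [exact hlen|lia| |].
  - intro i; rewrite !hbeq.
    replace (length b + 1)%nat with (length (b ++ [k + b0])) by apply length_app.
    apply is_period_periodic_seq; now destruct b.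
  - now rewrite (map_ext _ _ hbeq), periodic_seq_prefix_app.
Qed.

(** * From the fundamental solution to the expansion of [sqrt f(t)] *)

(** [hmin] asks for minimality among even periods only, so that [l] may also stand for a doubled odd
    period without its last entry. *)
Lemma fundamental_solution_cf_mat (f c h b0 : Z) (l : list Z) :
  0 < f -> ~ (exists m : Z, f = m ^ 2) ->
  is_periodic_cf (sqrt (IZR f)) b0 (l ++ [2 * b0]) ->
  Nat.even (length l) = false ->
  (forall m : nat, Nat.even m = false ->
    is_period (periodic_seq b0 (l ++ [2 * b0])) (m + 1) -> (length l <= m)%nat) ->
  is_fundamental_solution f c h ->
  c = b0 * m11 (cf_mat l) + m12 (cf_mat l) /\ h = m11 (cf_mat l).
Proof.
  intros hf hfsq hcf hodd hmin [hpell hsmall].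
  destruct (sqrt_periodic_cf_mat f b0 l hf hfsq hcf) as [hsym heq].
  assert (hpos := is_periodic_cf_pos _ _ _ hcf).
  apply Forall_app in hpos; destruct hpos as [hl hb0]; apply Forall_inv in hb0.
  pose proof (cf_mat_det l) as hdet; rewrite hodd, hsym in hdet.
  destruct (cf_mat_nonneg l hl) as [hA [hB _]].
  destruct (pell_solution_period f c h _ hf hcf hpell) as [m [hm [hper hhm]]].
  specialize (hmin m hm hper).
  assert (hle : m11 (cf_mat l) <= h).
  { rewrite hhm; replace m with (length l + (m - length l))%nat by lia.
    rewrite seq_app, map_app, periodic_seq_prefix_app.
    apply cf_mat_app_le; [exact hl|].
    apply Forall_map, Forall_forall; intros i hi; apply in_seq in hi.
    replace i with (S (i - 1)) by lia; apply hcf. }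
  (* By [heq], [(b0 A + B)^2 - f A^2] equals [B^2 - A D], which is 1 because [l] has odd length. *)
  destruct (hsmall (b0 * m11 (cf_mat l) + m12 (cf_mat l)) (m11 (cf_mat l)))
    as [hc hh]; [repeat split; nia|].
  destruct hpell as [hc0 [hh0 hpell]].
  assert (hhA : h = m11 (cf_mat l)) by lia.
  split; [|exact hhA].
  assert (hsq : (b0 * h + m12 (cf_mat l)) * (b0 * h + m12 (cf_mat l)) = c * c) by nia.
  rewrite <- hhA in *; nia.
Qed.

(** From [h = A] and [c - b0 h = B] follows [f(t) - (h t + b0)^2 = f - b0^2 + 2 B t]. Both sides of
    the second matrix equation thus grow by [2 A B t], while the first involves only [l]. *)
Lemma sqrt_fpoly_cf (f c h b0 t : Z) (l : list Z) :
  0 < f -> ~ (exists m : Z, f = m ^ 2) -> 0 <= t ->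
  is_periodic_cf (sqrt (IZR f)) b0 (l ++ [2 * b0]) ->
  Nat.even (length l) = false ->
  (forall m : nat, Nat.even m = false ->
    is_period (periodic_seq b0 (l ++ [2 * b0])) (m + 1) -> (length l <= m)%nat) ->
  is_fundamental_solution f c h ->
  is_periodic_cf (sqrt (IZR (fpoly f c h t))) (h * t + b0) (l ++ [2 * (h * t + b0)]).
Proof.
  intros hf hfsq ht hcf hodd hmin hfund.
  destruct (fundamental_solution_cf_mat f c h b0 l hf hfsq hcf hodd hmin hfund)
    as [hc hh].
  destruct (sqrt_periodic_cf_mat f b0 l hf hfsq hcf) as [hsym heq].
  assert (hpos := is_periodic_cf_pos _ _ _ hcf).
  apply Forall_app in hpos; destruct hpos as [hl hb0]; apply Forall_inv in hb0.
  destruct hfund as [[hc0 [hh0 _]] _].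
  apply sqrt_periodic_cf_of_mat; auto.
  - unfold fpoly; nia.
  - nia.
  - transitivity (m11 (cf_mat l) * (f - b0 * b0) + 2 * m12 (cf_mat l) * h * t).
    + unfold fpoly; rewrite <- hh; rewrite hc, <- hh; ring.
    + rewrite heq; ring.
Qed.

(** * Doubling an odd period *)

Lemma is_period_ext (b b' : nat -> Z) (m : nat) :
  (forall i, b i = b' i) -> is_period b m -> is_period b' m.
Proof. intros hb [hm hper]; split; [exact hm|]; intro i; rewrite <- !hb; apply hper. Qed.

Lemma periodic_seq_double (b0 : Z) (l : list Z) (i : nat) :
  l <> [] -> periodic_seq b0 (l ++ l) i = periodic_seq b0 l i.
Proof.
  intro hl; destruct i as [|i]; [reflexivity|]; simpl; rewrite length_app.
  assert (hlen : (0 < length l)%nat) by (destruct l; [easy|simpl; lia]).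
  replace (length l + length l)%nat with (length l * 2)%nat by lia.
  (* The index splits into a position within [l] and a bit that selects the copy. *)
  rewrite Nat.Div0.mod_mul_r.
  pose proof (Nat.mod_upper_bound i (length l) ltac:(lia)).
  pose proof (Nat.mod_upper_bound (i / length l) 2 ltac:(lia)).
  destruct ((i / length l) mod 2)%nat as [|[|q]]; [| |lia].
  - rewrite app_nth1 by lia; f_equal; lia.
  - rewrite app_nth2 by lia; f_equal; lia.
Qed.

(* An even period m' + 1 is a multiple of the odd minimal period m. *)
Lemma odd_period_length_double (b : nat -> Z) (m m' : nat) :
  is_period_length b m -> Nat.even m = false ->
  Nat.even m' = false -> is_period b (m' + 1) -> (2 * m <= m' + 1)%nat.
Proof.
  intros [[hm hper] hmin] hodd hodd' hper'.
  pose proof (hmin _ hper') as hle.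
  apply Nat.nlt_ge; intro hlt.
  destruct (Nat.eq_dec (m' + 1) m) as [e|e].
  { rewrite <- e, Nat.add_1_r, Nat.even_succ, <- Nat.negb_even, hodd' in hodd.
    discriminate. }
  (* Now [m < m' + 1 < 2 * m], so the difference of the two periods would be a period shorter than
     [m]. *)
  enough (h : is_period b (m' + 1 - m)) by (specialize (hmin _ h); lia).
  split; [lia|]; intro i.
  rewrite <- hper, <- (proj2 hper' i); do 2 f_equal; lia.
Qed.

Theorem theorem1 (f c h a0 : Z) (n : nat) (a : list Z)
  (hf : 0 < f)
  (hfsq : ~ exists m : Z, f = m ^ 2)
  (hn : length a = n)
  (hcf : is_periodic_cf (sqrt (IZR f)) a0 (a ++ [2 * a0]))
  (hper : is_period_length (periodic_seq a0 (a ++ [2 * a0])) (n + 1))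
  (hch : is_fundamental_solution f c h) :
  (Nat.Even n -> forall t : Z, 0 <= t ->
     is_periodic_cf (sqrt (IZR (fpoly f c h t))) (h * t + a0)
       (a ++ [2 * a0] ++ a ++ [2 * (h * t + a0)])) /\
  (Nat.Odd n -> forall t : Z, 0 <= t ->
     is_periodic_cf (sqrt (IZR (fpoly f c h t))) (h * t + a0)
       (a ++ [2 * (h * t + a0)])) /\
  (forall t : Z, 0 <= t ->
     is_fundamental_solution (fpoly f c h t) (h ^ 2 * t + c) h).
Proof.
  split; [|split].
  - intros hev t ht; apply Nat.even_spec in hev.
    replace (a ++ [2 * a0] ++ a ++ [2 * (h * t + a0)])
      with ((a ++ [2 * a0] ++ a) ++ [2 * (h * t + a0)]) by now rewrite <- !app_assoc.
    (* For [n] even, the same sequence is read with its block written twice, so that the list before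
       the last [2 * a0] has odd length [2 * n + 1]. *)
    assert (hdbl : forall i, periodic_seq a0 (a ++ [2 * a0]) i
      = periodic_seq a0 ((a ++ [2 * a0] ++ a) ++ [2 * a0]) i).
    { intro i; rewrite <- periodic_seq_double by now destruct a.
      now rewrite <- !app_assoc. }
    assert (hlen : length (a ++ [2 * a0] ++ a) = S (2 * n))
      by (rewrite !length_app; simpl; lia).
    apply sqrt_fpoly_cf; auto.
    + exact (is_simple_cf_ext _ _ _ hdbl hcf).
    + rewrite hlen, Nat.even_succ, <- Nat.negb_even, Nat.even_mul; reflexivity.
    + intros m hm hperm.
      apply (is_period_ext _ _ _ (fun i => eq_sym (hdbl i))) in hperm.
      rewrite hlen.
      enough (2 * (n + 1) <= m + 1)%nat by lia.
      apply (odd_period_length_double _ _ _ hper); auto.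
      now rewrite Nat.add_1_r, Nat.even_succ, <- Nat.negb_even, hev.
  - intros hodd t ht; apply sqrt_fpoly_cf; auto.
    + rewrite hn, <- Nat.negb_odd; apply Nat.odd_spec in hodd; now rewrite hodd.
    + intros m _ hperm; apply (proj2 hper) in hperm; lia.
  - intros t ht; now apply pell_shift_fundamental.
Qed.
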